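(* For $n\ge4$: as $n\to\infty$, $\gamma(\Phi_{n,2})\sim\alpha(\Phi_{n,2})$. As $t\to\infty$, $\gamma(\Phi_{4,t})=o(\beta(\Phi_{4,t}))$. Here $\gamma$ is computed with respect to any phi labeling, and the statements hold for every graph of the respective families.
   Context: Phi graphs: take vertex-disjoint cycles $C^{(1)},\dots,C^{(t)}$, each of length at least two, with distinct distinguished edges $e^{(i)},f^{(i)}$ in $C^{(i)}$, and identify the edge $f^{(i)}$ (with its endpoints) with $e^{(i+1)}$ for $1\le i<t$. For $n\ge4$, $\Phi_{n,t}$ denotes the family of phi graphs built from $t$ cycles of length $n$ in such a way that each cycle shares vertices only with the cycle just preceding and the one just following it (so $\Phi_{n,2}$ is two $n$-cycles sharing one edge, and $\Phi_{4,t}$ is the ladder $P_2\times P_{t+1}$). With $p,q$ the numbers of vertices and edges and $k=q-p+1$ ($=t$), a phi labeling names $e^{(i)}$ as $e_{k-i+1}$ ($1\le i\le t$), and then, for $i=1,\dots,t$ in turn, the edges of the at most two paths forming $C^{(i)}-e^{(i)}-f^{(i)}$ (for $i=t$, $C^{(t)}-e^{(t)}$), each path taken starting from the edge adjacent to $e^{(i)}$, receive the largest unused names in decreasing order starting from $e_q$. Then $T=\{e_{k+1},\dots,e_q\}$ is a spanning tree; let $C_i$ ($1\le i\le k$) be the edge set of the unique cycle in $T+e_i$. For a monomial $m$ in variables $x_1,\dots,x_k$, $L_d(m)$ is the set of monomials of total degree $d$ dividing $m$; $l_d(G)=|L_d(x_1^{|C_1|-2}\cdots x_k^{|C_k|-2})|$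 and $\gamma(G)=\sum_{d=0}^{p-1}l_d(G)2^{p-d-1}$. $\alpha(G)$ is the number of acyclic orientations of $G$, and $$\beta(G)=\prod_{v\in V(G)}(\deg v+1)\prod_{uw\in E(G)}\exp\frac{-1}{2(\deg u+1)(\deg w+1)}.$$ $f\sim g$ means $f/g\to1$; $f=o(g)$ means $f/g\to0$. *)

(* Defs.v *)
From HB Require Import structures.
From mathcomp Require Import all_boot all_order all_algebra.
From mathcomp Require Import all_classical all_reals all_analysis.
(* The notations of mpoly clash with those of all_analysis. *)
From mathcomp Require mpoly.
Import (canonicals, coercions) mpoly.

Set Implicit Arguments.
Unset Strict Implicit.
Unset Printing Implicit Defensive.

Import Order.TTheory GRing.Theory Num.Theory.
Import numFieldNormedType.Exports.

(* Finite loopless multigraphs: cycles of length two are allowed in general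
   phi graphs, so parallel edges are too. *)
Record mgraph := MGraph {
  vertex : finType;
  edge : finType;
  ends : edge -> {set vertex};
  card_ends : forall e, #|ends e| = 2
}.

Definition deg (G : mgraph) (v : vertex G) : nat := #|[set e | v \in ends e]|.

Definition is_cycle (G : mgraph) (C : {set edge G}) : Prop :=
  exists (m : nat) (v : 'I_m -> vertex G) (e : 'I_m -> edge G),
    [/\ 2 <= m, injective v, injective e,
        forall i, ends (e i) = [set v i; v (ordS i)]
      & C = [set e i | i : 'I_m]].

(* An orientation is the choice of a head for every edge. *)
Definition orientation (G : mgraph) (h : {ffun edge G -> vertex G}) : bool :=
  [forall e, h e \in ends e].

Definition arc (G : mgraph) (h : {ffun edge G -> vertex G}) : rel (vertex G) :=
  fun x y => [exists e, (h e == y) && (ends e == [set x; y])].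

Definition acyclic (G : mgraph) (h : {ffun edge G -> vertex G}) : Prop :=
  forall s : seq (vertex G), ucycle (arc h) s -> s = [::].

Definition alpha (G : mgraph) : nat :=
  #|[set h : {ffun edge G -> vertex G} | orientation h && `[< acyclic h >]]|.

Definition beta (R : realType) (G : mgraph) : R :=
  ((\prod_(v : vertex G) (deg v).+1%:R) *
   \prod_(e : edge G)
      expR (- 1 / (2 * \prod_(v in ends e) (deg v).+1%:R)))%R.

Definition cyclomatic (G : mgraph) : nat := (#|edge G|).+1 - #|vertex G|.

(* A labeling [lab] names the edges e_1, ..., e_q, with e_j := lab j for
   1 <= j <= q = #|edge G|; other values of [lab] are irrelevant. *)
Definition lab_tree (G : mgraph) (lab : nat -> edge G) : {set edge G} :=
  [set lab j | j : 'I_(#|edge G|).+1 & cyclomatic G < j].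

(* Some cycle of T + e_j; it is the only one when T is a spanning tree. *)
Definition fund_cycle (G : mgraph) (lab : nat -> edge G) (j : nat) :
    {set edge G} :=
  odflt finset.set0
    [pick C : {set edge G} |
      `[< is_cycle C >] && (C \subset lab j |: lab_tree lab)].

Definition cycle_monomial (G : mgraph) (lab : nat -> edge G) :
    mpoly.multinom (cyclomatic G) :=
  mpoly.Multinom [tuple #|fund_cycle lab i.+1| - 2 | i < cyclomatic G].

(* Monomials are exponent vectors, and [mpoly.lem] is divisibility. *)
Definition L (k d : nat) (m : mpoly.multinom k) :
    {set mpoly.bmultinom k d.+1} :=
  [set u : mpoly.bmultinom k d.+1 | (mpoly.mdeg u == d) && mpoly.lem u m].

Definition gamma (G : mgraph) (lab : nat -> edge G) : nat :=
  \sum_(d < #|vertex G|)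
     #|L d (cycle_monomial lab)| * 2 ^ (#|vertex G| - d - 1).

(* In the i-th cycle, of length [len i], both vertices and edges are numbered
   by 'I_(len i), edge j joining vertices j and ordS j. [flip i] tells which of
   the two ways of matching the endpoints is used to glue [cf i] with the first
   distinguished edge of the next cycle. *)
Record phi_data (t : nat) := PhiData {
  len : 'I_t -> nat;
  len_ge2 : forall i, 2 <= len i;
  ce : forall i, 'I_(len i);
  cf : forall i, 'I_(len i);
  ce_neq_cf : forall i, ce i != cf i;
  flip : 'I_t -> bool
}.

(* Vertices (resp. edges) of the disjoint union of the cycles. *)
Definition du (t : nat) (D : phi_data t) : finType := {i : 'I_t & 'I_(len D i)}.

Definition mkdu (t : nat) (D : phi_data t) (i : 'I_t) (j : 'I_(len D i)) : du D :=
  Tagged (fun i => 'I_(len D i)) j.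

Definition duS (t : nat) (D : phi_data t) (x : du D) : du D :=
  mkdu (ordS (tagged x)).

Definition eglue (t : nat) (D : phi_data t) : rel (du D) := fun x y =>
  [&& tag y == (tag x).+1 :> nat, tagged x == cf D (tag x)
    & tagged y == ce D (tag y)].

Definition vglue (t : nat) (D : phi_data t) : rel (du D) := fun x y =>
  let f := cf D (tag x) in let e := ce D (tag y) in
  (tag y == (tag x).+1 :> nat) &&
  (if flip D (tag x)
   then (tagged x == f) && (tagged y == ordS e)
        || (tagged x == ordS f) && (tagged y == e)
   else (tagged x == f) && (tagged y == e)
        || (tagged x == ordS f) && (tagged y == ordS e)).

Definition eqv_closure (T : finType) (r : rel T) : rel T :=
  connect (fun x y => r x y || r y x).

(* A phi graph is a quotient of the disjoint union of the cycles by the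
   equivalence relations generated by the identifications. *)
Record phi_graph (t : nat) := PhiGraph {
  pdata : phi_data t;
  pgraph :> mgraph;
  qV : du pdata -> vertex pgraph;
  qE : du pdata -> edge pgraph;
  qV_surj : forall v, exists x, qV x = v;
  qE_surj : forall e, exists x, qE x = e;
  qV_eq : forall x y, qV x = qV y <-> eqv_closure (@vglue t pdata) x y;
  qE_eq : forall x y, qE x = qE y <-> eqv_closure (@eglue t pdata) x y;
  ends_qE : forall x, ends (qE x) = [set qV x; qV (duS x)]
}.

Definition cyc_vertices (t : nat) (G : phi_graph t) (i : 'I_t) :
    {set vertex G} :=
  [set qV (mkdu j) | j : 'I_(len (pdata G) i)].

Definition Phi (n t : nat) (G : phi_graph t) : Prop :=
  (forall i : 'I_t, len (pdata G) i = n) /\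
  (forall i j : 'I_t, i.+1 < j -> [disjoint cyc_vertices G i & cyc_vertices G j]).

(* The edges of the i-th cycle that receive tree names, in the order in which
   they are named: [ordS] and [ord_pred] walk around the cycle from [ce i] in
   the two directions, up to [cf i] excluded, and all the way round for the
   last cycle. The boolean chooses the path that comes first (for the last
   cycle, the end from which its single path is traversed). *)
Definition upto (T : eqType) (x : T) (s : seq T) : seq T := take (index x s) s.

Definition path_edges (t : nat) (D : phi_data t) (c : bool) (i : 'I_t) :
    seq 'I_(len D i) :=
  let e := ce D i in let f := cf D i in
  let up := traject (@ordS _) (ordS e) (len D i).-1 in
  let down := traject (@ord_pred _) (ord_pred e) (len D i).-1 in
  if i.+1 == t then (if c then up else down)
  else if c then upto f up ++ upto f down else upto f down ++ upto f up.

Definition tree_edges (t : nat) (G : phi_graph t) (c : 'I_t -> bool) :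
    seq (edge G) :=
  flatten [seq [seq qE (mkdu j) | j <- path_edges (pdata G) (c i) i]
          | i <- enum 'I_t].

(* As i : 'I_t starts at 0, the first distinguished edge of the i-th cycle is
   named e_{k-i}. *)
Definition phi_labeling (t : nat) (G : phi_graph t) (lab : nat -> edge G) : Prop :=
  (forall i : 'I_t, lab (cyclomatic G - i) = qE (mkdu (ce (pdata G) i))) /\
  exists c : 'I_t -> bool,
    mkseq (fun j => lab (#|edge G| - j)) (size (tree_edges G c)) = tree_edges G c.

Local Open Scope classical_set_scope.
Local Open Scope ring_scope.

Definition asymp_equiv (R : realType) (f g : nat -> R) : Prop :=
  (f n / g n) @[n --> \oo] --> (1 : R).

Definition asymp_negl (R : realType) (f g : nat -> R) : Prop :=
  (f n / g n) @[n --> \oo] --> (0 : R).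

(* Main.v *)
(* A phi graph built from [t] cycles is a quotient of their disjoint union in
   which every class has a canonical representative ([erep], [vrep]), lying in
   the earliest possible cycle; this gives the numbers of vertices and edges.

   Summing [2 ^- (total degree)] over all monomials factors into [k] geometric
   series, each of sum at most 2, so [gamma <= 2 ^ (p - 1 + k) = 2 ^ q]; the
   inequality is asymptotically sharp if [k] is fixed and all the fundamental
   cycles get long.

   For two [n]-cycles sharing an edge, the vertices outside this edge have
   degree two, so any cycle contains one of the two paths of length [n - 1]
   obtained by removing it. Hence fundamental cycles are long, and
   [gamma ~ 2 ^ q]. Likewise an orientation with a directed cycle directs one
   of these paths consistently, which happens for at most a proportion
   [4 / 2 ^ (n - 1)] of the [2 ^ q] orientations, so [alpha ~ 2 ^ q].

   For the ladder [q = 3 t + 1], so [gamma <= 2 * 8 ^ t], whereas the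
   [2 (t - 1)] vertices of degree at least three give
   [beta >= 16 ^ (t - 1) * (7 / 8) ^ (3 t + 1)], of growth rate above 10. *)
Require Import Defs.
From HB Require Import structures.
From mathcomp Require Import all_boot all_order all_algebra.
From mathcomp Require Import all_classical all_reals all_analysis.
From mathcomp Require mpoly.
From mathcomp Require Import zify lra ring.
Import (canonicals, coercions) mpoly.

Set Implicit Arguments.
Unset Strict Implicit.
Unset Printing Implicit Defensive.

(** * Generated equivalences and their quotients, via representatives *)

Lemma eqv_closure_invariant (T : finType) (r : rel T) (s : T -> T) :
  (forall x y, r x y -> s x = s y) ->
  forall x y, eqv_closure r x y -> s x = s y.
Proof.
move=> rs x y /connectP[p]; elim: p x => [|z p IHp] x /=; first by move=> _ ->.
by case/andP=> xz zp yE; rewrite -(IHp z zp yE); case/orP: xz => /rs.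
Qed.

(** The map [s] is constant along [r] and moves a point only along [r], so it selects one point in
    each class. *)
Lemma eqv_closure_rep (T : finType) (r : rel T) (s : T -> T) :
  (forall x y, r x y -> s x = s y) -> (forall x, s x != x -> r (s x) x) ->
  forall x y, eqv_closure r x y <-> s x = s y.
Proof.
move=> rs sr x y; split; first exact: eqv_closure_invariant.
have sx z : eqv_closure r (s z) z.
  have [{1}->|/sr rsz] := eqVneq (s z) z; first exact: connect0.
  by apply: connect1; rewrite rsz.
have sC z1 z2 : eqv_closure r z1 z2 -> eqv_closure r z2 z1.
  by rewrite /eqv_closure sym_connect_sym // => a b; rewrite orbC.
by move=> sE; apply: connect_trans (sx y); rewrite -sE; apply: sC.
Qed.

Lemma card_quotient_rep (T Q : finType) (q : T -> Q) (s : T -> T) :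
  (forall v, exists x, q x = v) -> (forall x y, q x = q y <-> s x = s y) ->
  (forall x, s (s x) = s x) -> #|Q| = #|[set x | s x == x]|.
Proof.
move=> qsurj qE ss; rewrite -cardsT.
rewrite -(card_in_imset (f := q) (D := [set x | s x == x])).
  apply: eq_card => v; rewrite inE; apply/esym/imsetP.
  have [x <-] := qsurj v; exists (s x); first by rewrite inE ss.
  by apply/qE; rewrite ss.
by move=> x y; rewrite !inE => /eqP sx /eqP sy /qE; rewrite sx sy.
Qed.

(** * Representatives of glued edges and vertices in the earliest cycle *)

Lemma ordS_neq n (x : 'I_n) : 2 <= n -> ordS x != x.
Proof.
move=> n2; apply/eqP => /(congr1 val) /=; have xn := ltn_ord x.
have [E|?] := eqVneq x.+1 n; first by rewrite {1}E modnn; lia.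
by rewrite modn_small; lia.
Qed.

Lemma ord_pred_val t (i : 'I_t) : 0 < i -> (i + t).-1 %% t = i.-1.
Proof.
move=> i0; have -> : (i + t).-1 = i.-1 + t by lia.
by rewrite modnDr modn_small //; have := ltn_ord i; lia.
Qed.

(** Here [x] is read as a vertex and [g] as an edge, whose endpoints are the vertices [g] and
    [ordS g]. *)
Definition on_edge n (g x : 'I_n) : bool := (x == g) || (x == ordS g).

Section Representatives.
Variables (t : nat) (D : phi_data t).
Implicit Types (x y : du D) (i : 'I_t).

(** This keeps chains of vertex identifications short: no vertex is glued both backwards and
    forwards, so one step back reaches the representative. *)
Definition gluings_disjoint : Prop := forall i, 0 < i -> i.+1 < t ->
  forall j : 'I_(len D i), on_edge (cf D i) j -> ~~ on_edge (ce D i) j.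

Definition erep x : du D :=
  if (0 < tag x) && (tagged x == ce D (tag x))
  then mkdu (cf D (ord_pred (tag x))) else x.

(** The exclusive or matches endpoints as [vglue] does: the vertex [ce] goes to [f] without a flip,
    to [ordS f] with one. *)
Definition vrep x : du D :=
  let f := cf D (ord_pred (tag x)) in
  let b := flip D (ord_pred (tag x)) in
  if (0 < tag x) && on_edge (ce D (tag x)) (tagged x)
  then mkdu (if b (+) (tagged x == ce D (tag x)) then f else ordS f) else x.

Lemma ce_ordS i : ordS (ce D i) != ce D i.
Proof. exact/ordS_neq/len_ge2. Qed.

Lemma cf_ordS i : ordS (cf D i) != cf D i.
Proof. exact/ordS_neq/len_ge2. Qed.

Lemma eglue_rep x y : eglue x y -> erep y = x /\ erep x = x.
Proof.
case: x y => [i a] [j b] /and3P[/= /eqP ji /eqP -> /eqP ->].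
have iE : i = ord_pred j by apply: val_inj; rewrite /= ord_pred_val ji.
rewrite /erep /= ji eqxx /=; split; first by rewrite -iE.
by rewrite eq_sym (negPf (ce_neq_cf D i)) andbF.
Qed.

Lemma erep_eglue x : erep x != x -> eglue (erep x) x.
Proof.
rewrite /erep; case: ifP; last by rewrite eqxx.
move=> /andP[x0 xe] _; rewrite /eglue /= eqxx xe ord_pred_val //.
by rewrite prednK // eqxx.
Qed.

Lemma vglue_on x y : vglue x y ->
  [/\ tag y = (tag x).+1 :> nat, on_edge (cf D (tag x)) (tagged x)
    & vrep y = x].
Proof.
case: x y => [i a] [j b] /= /andP[/= /eqP ji].
have iE : i = ord_pred j by apply: val_inj; rewrite /= ord_pred_val ji.
move: a; rewrite iE in ji *; move=> a.
have j0 : 0 < j by rewrite ji.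
rewrite /vrep /= j0 /on_edge.
have [eN fN] := (ce_ordS j, cf_ordS (ord_pred j)).
case: (flip D _) => /orP[] /andP[/eqP -> /eqP ->];
  by split=> //; rewrite ?eqxx ?(negPf eN) /= ?orbT.
Qed.

Lemma vrep_vglue x : vrep x != x -> vglue (vrep x) x.
Proof.
rewrite /vrep; case: ifP; last by rewrite eqxx.
move=> /andP[x0 xe] _; rewrite /vglue /= ord_pred_val // prednK // eqxx /=.
have := cf_ordS (ord_pred (tag x)).
move: xe; rewrite /on_edge; have := ce_ordS (tag x).
case: (flip D _); have [->|_] := eqVneq (tagged x) (ce D (tag x)) => /= eN;
  by [rewrite !eqxx ?orbT | move=> /eqP ->; rewrite !eqxx ?orbT].
Qed.

Lemma vrep_cf x : gluings_disjoint -> (tag x).+1 < t ->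
  on_edge (cf D (tag x)) (tagged x) -> vrep x = x.
Proof.
move=> sep xt xf; rewrite /vrep; case: ifP => // /andP[x0].
by move/negP: (sep _ x0 xt _ xf).
Qed.

Lemma vglue_rep x y : gluings_disjoint -> vglue x y -> vrep y = x /\ vrep x = x.
Proof.
move=> sep xy; have [yx xf ->] := vglue_on xy; split=> //.
by apply: vrep_cf => //; rewrite -yx.
Qed.

Lemma erep_id x : erep (erep x) = erep x.
Proof.
have [E|/erep_eglue/eglue_rep[]//] := eqVneq (erep x) x.
by rewrite !E.
Qed.

Lemma vrep_id x : gluings_disjoint -> vrep (vrep x) = vrep x.
Proof.
move=> sep; have [E|/vrep_vglue/(vglue_rep sep)[]//] := eqVneq (vrep x) x.
by rewrite !E.
Qed.

Lemma erep_fixed (x : du D) :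
  (erep x == x) = ~~ ((0 < tag x) && (tagged x == ce D (tag x))).
Proof.
rewrite /erep; case: ifP => [/andP[x0 _]|]; last by rewrite eqxx.
apply: negbTE; apply/eqP => /(congr1 (fun y : du D => val (tag y))) /=.
by rewrite ord_pred_val //; move: x0; case: (nat_of_ord _) => //= m _; lia.
Qed.

Lemma vrep_fixed (x : du D) :
  (vrep x == x) = ~~ ((0 < tag x) && on_edge (ce D (tag x)) (tagged x)).
Proof.
rewrite /vrep; case: ifP => [/andP[x0 _]|]; last by rewrite eqxx.
apply: negbTE; apply/eqP => /(congr1 (fun y : du D => val (tag y))) /=.
by rewrite ord_pred_val //; move: x0; case: (nat_of_ord _) => //= m _; lia.
Qed.

End Representatives.

Section PhiQuotient.
Variables (t : nat) (G : phi_graph t).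
Let D := pdata G.
Implicit Types (x y : du D) (i : 'I_t).

Lemma qE_rep x y : qE x = qE y <-> erep x = erep y.
Proof.
rewrite -(eqv_closure_rep (r := @eglue t D)); first exact: qE_eq.
  by move=> {}x {}y /eglue_rep[-> ->].
exact: erep_eglue.
Qed.

Lemma vglue_qV x y : vglue x y -> qV x = qV y.
Proof. by move=> xy; apply/qV_eq/connect1; rewrite xy. Qed.

Hypothesis sep : gluings_disjoint D.

Lemma qV_rep x y : qV x = qV y <-> vrep x = vrep y.
Proof.
rewrite -(eqv_closure_rep (r := @vglue t D)); first exact: qV_eq.
  by move=> {}x {}y /(vglue_rep sep)[-> ->].
exact: vrep_vglue.
Qed.

End PhiQuotient.

Lemma vglue_next t (D : phi_data t) (i : 'I_t) (j : 'I_(len D i)) :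
  i.+1 < t -> on_edge (cf D i) j ->
  exists2 k : 'I_(len D (ordS i)), on_edge (ce D (ordS i)) k &
    vglue (mkdu j) (mkdu k).
Proof.
move=> it jf; pose e := ce D (ordS i).
exists (if flip D i (+) (j == ordS (cf D i)) then ordS e else e).
  by rewrite /on_edge; case: ifP; rewrite eqxx ?orbT.
rewrite /vglue /= modn_small // eqxx /=; have := cf_ordS D i.
case: (flip _ _); case/orP: jf => /eqP -> fN; rewrite ?eqxx /=;
  by rewrite 1?[_ == ordS _]eq_sym ?(negPf fN) /= ?eqxx ?orbT.
Qed.

(** A common endpoint of both glued edges of cycle [i] would belong to the cycle before and to the
    cycle after, which [Phi] makes disjoint. *)
Lemma Phi_gluings_disjoint n t (G : phi_graph t) :
  Phi n G -> gluings_disjoint (pdata G).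
Proof.
case=> _ dis i i0 it j jf; apply/negP => je.
have xy : vglue (vrep (mkdu j)) (mkdu j).
  apply: vrep_vglue; rewrite /vrep /= i0 je /=.
  apply/eqP => /(congr1 (fun x => val (tag x))).
  by rewrite /= ord_pred_val //; lia.
have /= [yx _ _] := vglue_on xy.
have [k _ jk] := vglue_next it jf.
pose z : du (pdata G) := mkdu k.
have : [disjoint cyc_vertices G (tag (vrep (mkdu j))) & cyc_vertices G (tag z)].
  by apply: dis; rewrite /z /= modn_small // -yx.
move/pred0P => /(_ (qV (mkdu j))) /= /negP; apply; apply/andP; split.
  by rewrite -(vglue_qV xy); apply/imsetP; exists (tagged (vrep (mkdu j))) => //;
     case: (vrep _).
by rewrite (vglue_qV jk); apply/imsetP; exists (tagged z).
Qed.

(** * Numbers of vertices and edges *)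

Lemma card_du_pred t (D : phi_data t) (P : pred (du D)) (a m : nat)
    (i0 : 'I_t) :
  #|[set j | P (mkdu (i := i0) j)]| = a ->
  (forall i : 'I_t, i != i0 -> #|[set j | P (mkdu (i := i) j)]| = m) ->
  #|[set x | P x]| = a + m * t.-1.
Proof.
move=> P0 Pi.
have -> : #|[set x | P x]| = \sum_(i < t) #|[set j | P (mkdu (i := i) j)]|.
  rewrite -sum1_card; under [in RHS]eq_bigr => i _ do rewrite -sum1_card.
  by rewrite sig_big_dep /=; apply: eq_bigl => -[i j]; rewrite !inE.
rewrite (bigD1 i0) //= P0 (eq_bigr (fun=> m)) // sum_nat_const mulnC.
congr (_ + _ * _).
by rewrite -[in RHS](card_ord t) -(cardC1 i0); apply: eq_card => i; rewrite !inE.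
Qed.

Section PhiCounts.
Variables (n t : nat) (G : phi_graph t).
Hypotheses (t1 : 0 < t) (GPhi : Phi n G).
Let D := pdata G.

Let i0 : 'I_t := Ordinal t1.

Let i0P (i : 'I_t) : (i != i0) = (0 < i).
Proof. by rewrite lt0n. Qed.

(** Fixed points of [erep] are counted: the first cycle keeps its [n] edges, every later one gives
    up its [ce]. *)
Lemma card_edge_Phi : #|edge G| = n + (n - 1) * t.-1.
Proof.
rewrite (card_quotient_rep (@qE_surj t G) (@qE_rep t G) (@erep_id t D)).
rewrite (@card_du_pred t D (fun x => erep x == x) n (n - 1) i0) //.
  rewrite -(GPhi.1 i0) -[RHS]card_ord -cardsT.
  by apply: eq_card => j; rewrite !inE erep_fixed.
move=> i; rewrite i0P => ii.
rewrite -(GPhi.1 i) cardsCs card_ord -(cards1 (ce D i)); congr (_ - _).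
by apply: eq_card => j; rewrite !inE erep_fixed /= ii negbK.
Qed.

Lemma card_vertex_Phi : #|vertex G| = n + (n - 2) * t.-1.
Proof.
have sep := Phi_gluings_disjoint GPhi.
rewrite (card_quotient_rep (@qV_surj t G) (qV_rep sep) (fun x => vrep_id x sep)).
rewrite (@card_du_pred t D (fun x => vrep x == x) n (n - 2) i0) //.
  rewrite -(GPhi.1 i0) -[RHS]card_ord -cardsT.
  by apply: eq_card => j; rewrite !inE vrep_fixed.
move=> i; rewrite i0P => ii.
rewrite -(GPhi.1 i) cardsCs card_ord.
have <- : #|[set ce D i; ordS (ce D i)]| = 2 by rewrite cards2 eq_sym ce_ordS.
by congr (_ - _); apply: eq_card => j; rewrite !inE vrep_fixed /= ii negbK.
Qed.

Lemma cyclomatic_Phi : 2 <= n -> cyclomatic G = t.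
Proof.
rewrite /cyclomatic card_edge_Phi card_vertex_Phi.
by case: t t1 => // t' _ /=; nia.
Qed.

End PhiCounts.

(** * Degrees of the vertices on glued edges *)

Section Degrees.
Variables (n t : nat) (G : phi_graph t).
Hypothesis (GPhi : Phi n G).
Let D := pdata G.
Let sep := Phi_gluings_disjoint GPhi.

(** At most one edge of a cycle is moved by [erep], and it lands in a different cycle. *)
Lemma qE_cycle_inj (i : 'I_t) : injective (fun j : 'I_(len D i) => qE (mkdu j)).
Proof.
move=> j1 j2 /qE_rep; rewrite /erep /=.
have tagN : 0 < i -> ord_pred i <> i.
  by move=> ii /(congr1 val) /=; rewrite ord_pred_val //; lia.
case: (posnP i) => ii /=; first by move=> E; apply: (eq_from_Tagged E).
by case: eqP => [->|_]; case: eqP => [->|_] //;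
  [move/(congr1 (fun y : du D => tag y))/(tagN ii)
  |move/esym/(congr1 (fun y : du D => tag y))/(tagN ii)
  |move=> E; apply: (eq_from_Tagged E)].
Qed.

Lemma vertex_in_ends (x : du D) : qV x \in ends (qE x).
Proof. by rewrite ends_qE !inE eqxx. Qed.

Lemma vertex_in_ends_pred (i : 'I_t) (j : 'I_(len D i)) :
  qV (mkdu j) \in ends (qE (mkdu (ord_pred j))).
Proof. by rewrite ends_qE !inE /duS /= ord_predK eqxx orbT. Qed.

Lemma tag_erep (x : du D) : tag (erep x) <= tag x.
Proof.
rewrite /erep; case: ifP => [/andP[x0 _]|_] //=.
by rewrite ord_pred_val // leq_pred.
Qed.

(** Two edges at the vertex come from its own cycle; the third comes from the next cycle, where each
    endpoint of [ce] lies on an edge other than [ce]. *)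
Lemma deg_shared (x : du D) : (tag x).+1 < t ->
  on_edge (cf D (tag x)) (tagged x) -> 2 < deg (qV x : vertex G).
Proof.
case: x => i j /= it jf.
have [k ke /vglue_qV jk] := vglue_next it jf.
have [g gN kg] : exists2 g : 'I_(len D (ordS i)), g != ce D (ordS i) &
    qV (mkdu k) \in ends (qE (mkdu g)).
  have [ek|] := eqVneq k (ce D (ordS i)); last first.
    by exists k => //; apply: vertex_in_ends.
  exists (ord_pred k); last exact: vertex_in_ends_pred.
  rewrite -ek -(inj_eq (@ordS_inj _)) ord_predK eq_sym.
  exact/ordS_neq/len_ge2.
have gF : erep (mkdu g) = mkdu g.
  by rewrite /erep /= (negPf gN) andbF.
(* Taking representatives never increases the tag, whereas [mkdu g] represents itself with tag
   [i + 1]. *)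
have neq (x : du D) : tag x = i -> qE x != qE (mkdu g).
  move=> xi; apply/eqP => /qE_rep; rewrite gF.
  move=> /(congr1 (fun y : du D => val (tag y))) /=.
  by rewrite modn_small // => E; have := tag_erep x; rewrite E xi ltnn.
apply/card_gt2P; exists (qE (mkdu j)), (qE (mkdu (ord_pred j))), (qE (mkdu g)).
split; split; rewrite ?inE ?vertex_in_ends ?vertex_in_ends_pred //.
- by rewrite [qV _]jk.
- apply/eqP => /qE_cycle_inj /(congr1 (@ordS _)); rewrite ord_predK => /eqP.
  by rewrite (negPf (ordS_neq _ (len_ge2 _ _))).
- exact: neq.
- by rewrite eq_sym; apply: neq.
Qed.

(** Every cycle but the last contributes the two endpoints of its [cf]; these are their own
    representatives, hence distinct in the quotient. *)
Lemma card_deg_gt2 : 0 < t -> 2 * t.-1 <= #|[set v : vertex G | 2 < deg v]|.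
Proof.
move=> t1.
pose X := [set x : du D | ((tag x).+1 < t) && on_edge (cf D (tag x)) (tagged x)].
have t1' : t.-1 < t by rewrite prednK.
have <- : #|X| = 2 * t.-1.
  rewrite -[RHS]add0n; apply: (card_du_pred (i0 := Ordinal t1')) => [|i it].
    by apply: eq_card0 => j; rewrite !inE /= prednK // ltnn.
  have it' : i.+1 < t.
    have := ltn_ord i; have : i <> t.-1 :> nat by apply/eqP.
    by move=> *; lia.
  rewrite -(_ : #|[set cf D i; ordS (cf D i)]| = 2).
    by apply: eq_card => j; rewrite !inE /= it'.
  by rewrite cards2 eq_sym cf_ordS.
rewrite -(card_in_imset (f := fun x => qV x : vertex G) (D := X)).
  apply/subset_leq_card/fintype.subsetP => v /imsetP[x xX ->].
  by move: xX; rewrite !inE => /andP[xt xf]; apply: deg_shared.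
move=> x y; rewrite !inE => /andP[xt xf] /andP[yt yf] /(qV_rep sep).
by rewrite !vrep_cf.
Qed.

End Degrees.

Lemma deg_gt0_in_ends (G : mgraph) (e : edge G) (v : vertex G) :
  v \in ends e -> 0 < deg v.
Proof. by move=> ve; apply/card_gt0P; exists e; rewrite inE. Qed.

Lemma prod_deg_ge (G : mgraph) :
  4 ^ #|[set v : vertex G | 2 < deg v]| <= \prod_(v : vertex G) (deg v).+1.
Proof.
rewrite -prod_nat_const big_mkcond /=; apply: leq_prod => v _.
by rewrite inE; case: ifP.
Qed.

Lemma prod_ends_ge (G : mgraph) (e : edge G) :
  4 <= \prod_(v in ends e) (deg v).+1.
Proof.
apply: (@leq_trans (\prod_(v in ends e) 2)).
  by rewrite prod_nat_const card_ends.
by apply: leq_prod => v /deg_gt0_in_ends.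
Qed.

(** * Walks around a cycle and along bare paths *)

Lemma iter_ordS_val n (x : 'I_n) m : iter m (@ordS n) x = (x + m) %% n :> nat.
Proof.
elim: m => [|m IHm]; first by rewrite addn0 modn_small.
by rewrite iterS /= IHm -addn1 modnDml addn1 addnS.
Qed.

Lemma iter_ordS_inj n (x : 'I_n) a b : a < n -> b < n ->
  iter a (@ordS n) x = iter b (@ordS n) x -> a = b.
Proof.
move=> an bn /(congr1 val) /=; rewrite !iter_ordS_val => /eqP.
by rewrite eqn_modDl !modn_small // => /eqP.
Qed.

Lemma iter_ordSn n (x : 'I_n) : iter n (@ordS n) x = x.
Proof. by apply: ord_inj; rewrite iter_ordS_val modnDr modn_small. Qed.

Lemma iter_ordS_surj n (x y : 'I_n) :
  exists2 m, m < n & y = iter m (@ordS n) x.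
Proof.
have n0 : 0 < n by apply: leq_ltn_trans (ltn_ord x).
exists ((y + n - x) %% n); first by rewrite ltn_mod.
apply: ord_inj; rewrite iter_ordS_val modnDmr.
have -> : x + (y + n - x) = y + n by have := ltn_ord x; lia.
by rewrite modnDr modn_small.
Qed.

(* In a path with consecutive vertices [v m] and edges [e m], the vertices
   strictly between the two ends have no other incident edges, so that a cycle
   through one of them has to follow the whole path. *)
Record bare_path (G : mgraph) (N : nat) (v : nat -> vertex G)
    (e : nat -> edge G) : Prop := BarePath {
  bare_ends : forall m, m < N -> ends (e m) = [set v m; v m.+1];
  bare_inj : forall a b, a <= N -> b <= N -> v a = v b -> a = b;
  bare_inner : forall m f, m.+1 < N -> v m.+1 \in ends f ->
                 f = e m \/ f = e m.+1
}.

(** Only the lower bound two on degrees is recorded: it is what cycles and supports of directed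
    cycles have in common. *)
Definition two_regular (G : mgraph) (S : {pred vertex G}) (C : {pred edge G}) :=
  (forall x, x \in S -> exists f g,
     [/\ f != g, f \in C /\ g \in C, x \in ends f & x \in ends g]) /\
  (forall f x, f \in C -> x \in ends f -> x \in S).

Definition directed_regular (G : mgraph) (h : {ffun edge G -> vertex G})
    (S : {pred vertex G}) :=
  forall x, x \in S -> exists f g,
    [/\ h f = x, h g <> x, x \in ends g,
        {subset ends f <= S} & {subset ends g <= S}].

Definition spanned (G : mgraph) (S : {pred vertex G}) : pred (edge G) :=
  [pred f | [forall x, (x \in ends f) ==> (x \in S)]].

Lemma directed_two_regular (G : mgraph) (h : {ffun edge G -> vertex G})
    (S : {pred vertex G}) :
  orientation h -> directed_regular h S -> two_regular S (spanned S).
Proof.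
move=> /forallP ho SP.
have CP f : {subset ends f <= S} -> f \in spanned S.
  by move=> fS; apply/forallP => x; apply/implyP/fS.
split=> [x /SP[f [g [fx gx xg fS gS]]]|f x /forallP/(_ x)/implyP //].
exists f, g; split=> //; last by rewrite -fx; apply: ho.
  by apply/eqP => fg; apply: gx; rewrite -fg.
by split; apply: CP.
Qed.

Section BarePath.
Variables (G : mgraph) (N : nat) (v : nat -> vertex G) (e : nat -> edge G).
Hypothesis vP : bare_path N v e.

(** At an inner vertex only the two path edges are available, so [C] contains both; this passes
    membership from edge to edge in both directions. *)
Lemma bare_path_closed (S : {pred vertex G}) (C : {pred edge G}) m :
  two_regular S C -> m.+1 < N -> v m.+1 \in S ->
  forall j, j < N -> e j \in C.
Proof.
move=> [SC CS] mN vm.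
have step j : j.+1 < N -> v j.+1 \in S -> e j \in C /\ e j.+1 \in C.
  move=> jN /SC[f [g [fg [fC gC] vf vg]]].
  case: (bare_inner vP jN vf) => fE; case: (bare_inner vP jN vg) => gE;
    by move: fg fC gC; rewrite fE gE ?eqxx.
have up j : e m.+1 \in C -> m.+1 + j < N -> e (m.+1 + j) \in C.
  move=> em; elim: j => [|j IHj]; rewrite ?addn0 // addnS => jN.
  apply: (step _ jN _).2; apply: (CS (e (m.+1 + j))); first exact/IHj/ltnW.
  by rewrite (bare_ends vP) ?inE ?eqxx ?orbT // ltnW.
have down j : e m \in C -> j <= m -> e (m - j) \in C.
  move=> em; elim: j => [|j IHj]; rewrite ?subn0 // => jm.
  have E : (m - j.+1).+1 = m - j by lia.
  apply: (step _ _ _).1; rewrite E; first lia.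
  apply: (CS (e (m - j))); first exact/IHj/ltnW.
  by rewrite (bare_ends vP) ?inE ?eqxx //; lia.
have [em em1] := step _ mN vm.
move=> j jN; have [mj|jm] := ltnP m j.
  by have := up (j - m.+1) em1; rewrite subnKC //; apply.
by have := down (m - j) em; rewrite subKn //; apply; rewrite leq_subr.
Qed.

(** At each inner vertex one of the two path edges enters and the other leaves, so consecutive edges
    point the same way. *)
Lemma bare_path_directed (h : {ffun edge G -> vertex G}) (S : {pred vertex G}) m :
  orientation h -> directed_regular h S -> m.+1 < N -> v m.+1 \in S ->
  (forall j, j < N -> h (e j) = v j.+1) \/ (forall j, j < N -> h (e j) = v j).
Proof.
move=> hor SP mN vm; have /forallP ho := hor.
have reg := directed_two_regular hor SP.
have eC := bare_path_closed reg mN vm.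
have vS j : j.+1 < N -> v j.+1 \in S.
  move=> jN; apply: (reg.2 _ _ (eC _ jN)).
  by rewrite (bare_ends vP) // !inE eqxx.
pose b j := h (e j) == v j.+1.
have bF j : j < N -> ~~ b j -> h (e j) = v j.
  move=> jN; have := ho (e j); rewrite (bare_ends vP) // !inE /b.
  by move=> /orP[/eqP|->].
have bT j : j < N -> b j -> h (e j) != v j.
  move=> jN /eqP ->; apply/eqP => /(bare_inj vP); lia.
have bS j : j.+1 < N -> b j = b j.+1.
  move=> jN; have [f [g [fv gv vg _ _]]] := SP _ (vS _ jN).
  have vf : v j.+1 \in ends f by rewrite -fv; apply: ho.
  have jN' := ltnW jN.
  case: (bare_inner vP jN vf) => fE; case: (bare_inner vP jN vg) => gE;
    rewrite fE in fv; rewrite gE in gv; try by case: gv.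
    rewrite {1}/b fv eqxx; apply/esym; apply/negPn/negP => /(bF _ jN) //.
  have -> : b j = false by apply/eqP.
  apply/esym/negP => /(bT _ jN); by rewrite fv eqxx.
have b0 j : j < N -> b j = b 0.
  by elim: j => // j IHj jN; rewrite -bS // IHj // ltnW.
case E : (b 0); [left=> j jN; apply/eqP|right=> j jN; apply: bF => //].
  by rewrite -[_ == _]/(b j) b0.
by rewrite b0 // E.
Qed.

End BarePath.

Lemma ucycle_directed_regular (G : mgraph) (h : {ffun edge G -> vertex G})
    (s : seq (vertex G)) :
  ucycle (Defs.arc h) s -> directed_regular h (mem s).
Proof.
move=> /andP[cs _] x xs.
have /existsP[f /andP[/eqP hf /eqP fE]] := prev_cycle cs xs.
have /existsP[g /andP[/eqP hg /eqP gE]] := next_cycle cs xs.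
exists f, g; split=> //.
(* If the head of [g] were [x], its set of ends would be a singleton; this covers the closed walk
   with one vertex. *)
- move=> gx; have := card_ends g; rewrite gE -hg gx finset.setUid cards1 //.
- by rewrite gE !inE eqxx.
- by move=> y; rewrite fE !inE => /orP[] /eqP -> //; rewrite mem_prev.
- by move=> y; rewrite gE !inE => /orP[] /eqP -> //; rewrite mem_next.
Qed.

Lemma qV_cycle_inj t (G : phi_graph t) (i : 'I_t) : gluings_disjoint (pdata G) ->
  injective (fun j : 'I_(len (pdata G) i) => qV (mkdu j)).
Proof.
move=> sep j1 j2 /(qV_rep sep); rewrite /vrep /=.
have tagN : 0 < i -> ord_pred i <> i.
  by move=> ii /(congr1 val) /=; rewrite ord_pred_val //; lia.
case: (posnP i) => ii /=; first by move=> E; apply: (eq_from_Tagged E).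
case: (boolP (on_edge _ j1)) => e1; case: (boolP (on_edge _ j2)) => e2 E;
  last exact: (eq_from_Tagged E).
- have fN := cf_ordS (pdata G) (ord_pred i).
  have := eq_from_Tagged E; move: e1 e2; rewrite /on_edge.
  case: (flip _ _); case: (eqVneq j1) => [->|_]; case: (eqVneq j2) => [->|_] //=;
    by [move=> _ _ /eqP; rewrite (negPf fN)
       |move=> _ _ /eqP; rewrite eq_sym (negPf fN)|move=> /eqP -> /eqP ->].
- by have /(tagN ii) := congr1 (fun y : du (pdata G) => tag y) E.
- by have /esym/(tagN ii) := congr1 (fun y : du (pdata G) => tag y) E.
Qed.

(** Any other vertex of the class would be sent by [vrep] to an endpoint of [cf] in cycle [i]. *)
Lemma qV_inner t (G : phi_graph t) (y : du (pdata G)) (i : 'I_t)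
    (j : 'I_(len (pdata G) i)) :
  gluings_disjoint (pdata G) ->
  ~~ ((0 < i) && on_edge (ce (pdata G) i) j) ->
  ~~ ((i.+1 < t) && on_edge (cf (pdata G) i) j) ->
  qV y = qV (mkdu j) -> y = mkdu j.
Proof.
move=> sep je jf /(qV_rep sep).
have -> : vrep (mkdu j) = mkdu j by apply/eqP; rewrite vrep_fixed; exact: je.
have [-> //|/vrep_vglue yy yj] := eqVneq (vrep y) y.
have [ty yf _] := vglue_on yy; move: ty yf jf; rewrite yj /= => ty -> .
by rewrite andbT -ty ltn_ord.
Qed.

(** * Two cycles sharing an edge: cycles and acyclic orientations *)

Definition shared (D : phi_data 2) (i : 'I_2) : 'I_(len D i) :=
  if i == 0 :> nat then cf D i else ce D i.

(* The [i]-th cycle minus the shared edge is the path with vertices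
   [qV (arm i m)] for [m < n] and edges [qE (arm i m)] for [m < n.-1]. *)
Definition arm (D : phi_data 2) (i : 'I_2) (m : nat) : du D :=
  mkdu (iter m (@ordS _) (ordS (shared D i))).

Section Theta.
Variables (n : nat) (G : phi_graph 2).
Hypotheses (n3 : 2 < n) (GPhi : Phi n G).
Let D := pdata G.
Let sep := Phi_gluings_disjoint GPhi.
Let lenE i : len D i = n := GPhi.1 i.

Lemma arm_last i : arm D i n.-1 = mkdu (shared D i).
Proof.
rewrite /arm -iterSr prednK; last lia.
by rewrite -(lenE i) iter_ordSn.
Qed.

Lemma arm_inj i a b : a < n -> b < n -> qV (arm D i a) = qV (arm D i b) -> a = b.
Proof.
by move=> an bn /(qV_cycle_inj sep); apply: iter_ordS_inj; rewrite lenE.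
Qed.

Lemma arm_edge_inj i a b :
  a < n -> b < n -> qE (arm D i a) = qE (arm D i b) -> a = b.
Proof.
by move=> an bn /(@qE_cycle_inj _ G); apply: iter_ordS_inj; rewrite lenE.
Qed.

Lemma arm_inner i m y : m.+2 < n -> qV y = qV (arm D i m.+1) -> y = arm D i m.+1.
Proof.
move=> mn.
(* The endpoints of the shared edge are the arm positions [n.-1] and 0, which [m.+1] avoids. *)
have on : ~~ on_edge (shared D i) (tagged (arm D i m.+1)).
  rewrite /arm /=; apply/negP => /orP[] /eqP E.
    have := congr1 (fun x => qV (mkdu x)) E.
    rewrite -[X in _ = X]/(qV (mkdu _)) -arm_last -[X in X = _]/(qV (arm D i m.+1)).
    by move=> /arm_inj; lia.
  have := congr1 (fun x => qV (mkdu x)) E.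
  rewrite -[X in _ = X]/(qV (arm D i 0)) -[X in X = _]/(qV (arm D i m.+1)).
  by move=> /arm_inj; lia.
apply: qV_inner => //; apply/negP => /andP[ii H]; move/negP: on; apply;
  by move: H; rewrite /shared; case: i ii => [[|[|k]] ik].
Qed.

Lemma shared_eq : forall i j : 'I_2, qE (mkdu (shared D i)) = qE (mkdu (shared D j)).
Proof.
have H (i j : 'I_2) : i = 0 :> nat -> j = 1 :> nat ->
    qE (mkdu (shared D i)) = qE (mkdu (shared D j)).
  move=> i0 j1; apply/qE_rep.
  have [|-> ->] // := @eglue_rep _ D (mkdu (shared D i)) (mkdu (shared D j)).
  by rewrite /eglue /= i0 j1 /= /shared i0 j1 /= !eqxx.
move=> i j; case: (eqVneq i j) => [->//|ij].
have := ltn_ord i; have := ltn_ord j.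
have : i <> j :> nat by move=> /ord_inj; apply/eqP.
case: (posnP i) => i0 *; first by apply: H => //; lia.
by apply/esym; apply: H; lia.
Qed.

Lemma arm_bare i :
  bare_path n.-1 (fun m => qV (arm D i m)) (fun m => qE (arm D i m)).
Proof.
split=> [m mn|a b an bn|m f mn].
- by rewrite ends_qE.
- by apply: arm_inj; lia.
(* The inner vertex has a single preimage, so [f] is the edge with the same number or the preceding
   one, according to which of its ends the vertex is. *)
have [x <-] := qE_surj f; rewrite ends_qE !inE => /orP[] /eqP /esym /arm_inner.
  by move=> -> ; [right|lia].
move=> xE; left; congr qE; have /xE : m.+2 < n by lia.
case: (x) => i' j' /= {}xE; have ii := congr1 (fun y : du D => tag y) xE.
rewrite /= in ii; subst i'.
by have /= /ordS_inj -> := eq_from_Tagged xE.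
Qed.

Lemma edge_cases (f : edge G) :
  (exists i m, m < n.-1 /\ f = qE (arm D i m)) \/
  (forall i, f = qE (mkdu (shared D i))).
Proof.
have [[i j] <-] := qE_surj f.
have [m] := iter_ordS_surj (ordS (shared D i)) j.
move=> mn jE; rewrite lenE in mn; have [mn'|mn'] := ltnP m n.-1.
  by left; exists i, m; rewrite jE.
right=> i'; rewrite (shared_eq i' i) -arm_last jE.
by have -> : m = n.-1 by lia.
Qed.

(** Of two distinct edges at [x] at most one is the shared edge, so [C] has an arm edge; as an arm
    has at least two edges, an endpoint of that edge is inner. *)
Lemma theta_two_regular (S : {pred vertex G}) (C : {pred edge G}) x :
  two_regular S C -> x \in S ->
  exists i m, m.+1 < n.-1 /\ qV (arm D i m.+1) \in S.
Proof.
move=> reg xS; have [f [g [fg [fC gC] _ _]]] := reg.1 x xS.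
have [i [m [mn iC]]] : exists i m, m < n.-1 /\ qE (arm D i m) \in C.
  case: (edge_cases f) => [[i [m [mn fE]]]|fE]; first by exists i, m; rewrite -fE.
  case: (edge_cases g) => [[i [m [mn gE]]]|gE]; first by exists i, m; rewrite -gE.
  by move: fg; rewrite (fE ord0) (gE ord0) eqxx.
have inS y : y \in ends (qE (arm D i m)) -> y \in S by apply: reg.2.
rewrite (bare_ends (arm_bare i)) // in inS; exists i.
case: m mn iC inS => [|m] mn iC inS; [exists 0|exists m]; split=> //; try lia;
  by apply: inS; rewrite !inE eqxx ?orbT.
Qed.

Lemma card_arm i : #|[set qE (arm D i m) | m : 'I_n.-1]| = n.-1.
Proof.
rewrite card_imset ?card_ord // => a b /arm_edge_inj ab.
by apply: ord_inj; apply: ab; have [] := (ltn_ord a, ltn_ord b); lia.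
Qed.

Lemma card_cycle (C : {set edge G}) : is_cycle C -> n.-1 <= #|C|.
Proof.
move=> [k [v [e [k2 vinj einj eE ->]]]].
have reg : two_regular [set v i | i : 'I_k] [set e i | i : 'I_k].
  split=> [x /imsetP[i _ ->]|f x /imsetP[i _ ->]].
    exists (e i), (e (ord_pred i)); split.
    - apply/eqP => /einj /(congr1 (@ordS _)) /eqP; rewrite ord_predK.
      by rewrite (negPf (ordS_neq _ k2)).
    - by split; apply: imset_f.
    - by rewrite eE !inE eqxx.
    - by rewrite eE ord_predK !inE eqxx orbT.
  by rewrite eE !inE => /orP[] /eqP ->; apply: imset_f.
have k0 : 0 < k by lia.
have [i [m [mn mS]]] :=
  theta_two_regular reg (imset_f v (isT : Ordinal k0 \in 'I_k)).
have iC := bare_path_closed (arm_bare i) reg mn mS.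
rewrite -(card_arm i); apply/subset_leq_card/fintype.subsetP => f /imsetP[j _ ->].
exact: iC.
Qed.

Lemma card_orientations : #|[set h | orientation (G := G) h]| = 2 ^ #|edge G|.
Proof.
rewrite -[RHS]prod_nat_const.
rewrite (_ : #|_| = #|family (fun f : edge G => mem (ends f))|).
  rewrite card_family foldrE big_map big_enum /=.
  by apply: eq_bigr => f _; rewrite card_ends.
by apply: eq_card => h; rewrite inE.
Qed.

Lemma alpha_le : alpha G <= 2 ^ #|edge G|.
Proof.
rewrite -card_orientations; apply/subset_leq_card/fintype.subsetP => h.
by rewrite !inE => /andP[].
Qed.

(* The heads allowed by directing the [i]-th arm consistently; there is no
   constraint on the edges outside it. *)
Definition directed_arm (c : bool) (i : 'I_2) (f : edge G) : {set vertex G} :=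
  [set x in ends f | [forall m : 'I_n.-1, (f == qE (arm D i m)) ==>
     (x == qV (arm D i (if c then m.+1 else m)))]].

(** The [n - 1] edges of the arm have a forced head, every other edge at most two choices. *)
Lemma card_directed_arm c i : #|family (fun f => mem (directed_arm c i f))| <=
  2 ^ (#|edge G| - n.-1).
Proof.
rewrite card_family foldrE big_map big_enum /=.
pose A := [set qE (arm D i m) | m : 'I_n.-1].
apply: (@leq_trans (\prod_(f : edge G) if f \in ~: A then 2 else 1)).
  apply: leq_prod => f _; rewrite inE; case: ifP => [_|/negbFE/imsetP[m _ fE]].
    rewrite -[leqRHS](card_ends f); apply/subset_leq_card/fintype.subsetP => x.
    by rewrite inE => /andP[].
  rewrite -[leqRHS](cards1 (qV (arm D i (if c then m.+1 else m)))).
  apply/subset_leq_card/fintype.subsetP => x.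
  rewrite !inE => /andP[_ /forallP/(_ m)].
  by rewrite fE eqxx.
rewrite -big_mkcond prod_nat_const; apply: eq_leq; congr (_ ^ _).
by rewrite cardsCs finset.setCK card_arm.
Qed.

Lemma not_acyclic_directed h : orientation (G := G) h -> ~ acyclic h ->
  exists c i, h \in family (fun f => mem (directed_arm c i f)).
Proof.
move=> ho; rewrite /acyclic => /existsNP[s /not_implyP[cs s0]].
have sP := ucycle_directed_regular cs.
have [x xs] : exists x, x \in s.
  by case: s s0 {cs sP} => // x s _; exists x; rewrite inE eqxx.
have [i [m [mn mS]]] := theta_two_regular (directed_two_regular ho sP) xs.
have hoP f : h f \in ends f by apply: (forallP ho).
have [H|H] := bare_path_directed (arm_bare i) ho sP mn mS;
  [exists true, i|exists false, i];
  apply/familyP => f; rewrite !inE hoP; apply/forallP => k; apply/implyP => /eqP ->;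
  by rewrite H.
Qed.

Lemma alpha_ge : 2 ^ #|edge G| <= alpha G + 4 * 2 ^ (#|edge G| - n.-1).
Proof.
rewrite -card_orientations.
(* Union bound: the factor 4 counts the pairs of a direction and an arm. *)
pose B := \bigcup_(ci : bool * 'I_2)
  [set h in family (fun f => mem (directed_arm ci.1 ci.2 f))].
apply: (@leq_trans (#|[set h | orientation h && `[< acyclic h >]] :|: B|)).
  apply/subset_leq_card/fintype.subsetP => h; rewrite !inE => ho; rewrite ho /=.
  case: asboolP => //= /(not_acyclic_directed ho)[c [i hci]].
  by apply/bigcupP; exists (c, i) => //; rewrite inE.
apply: leq_trans (leq_card_setU _ _).1 _; rewrite leq_add2l.
apply: (@leq_trans (\sum_(ci : bool * 'I_2) 2 ^ (#|edge G| - n.-1))).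
  apply: (big_ind2 (fun (A : {set {ffun edge G -> vertex G}}) m => #|A| <= m)).
  - by rewrite cards0.
  - move=> A a B' b Aa Bb; apply: leq_trans (leq_add Aa Bb).
    exact: (leq_card_setU _ _).1.
  - move=> [c i] _; apply: leq_trans (card_directed_arm c i).
    by apply: eq_leq; apply: eq_card => h; rewrite inE.
by rewrite sum_nat_const card_prod card_bool card_ord.
Qed.

End Theta.

(** * Phi labelings and their fundamental cycles *)

Lemma iter_ord_pred n (x : 'I_n) m : m <= n ->
  iter m (@ordS n) x = iter (n - m) (@ord_pred n) x.
Proof.
move=> mn; have K k y : iter k (@ord_pred n) (iter k (@ordS n) y) = y.
  by elim: k => // k IHk; rewrite iterSr iterS ordSK.
by rewrite -{1}(K (n - m) (iter m _ x)) -iterD subnK // iter_ordSn.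
Qed.

Lemma upto_traject (T : eqType) (f : T -> T) x n a :
  (forall b c, b < n -> c < n -> iter b f x = iter c f x -> b = c) -> a < n ->
  upto (iter a f x) (traject f x n) = traject f x a.
Proof.
move=> inj an; rewrite /upto -(nth_traject f an x) index_uniq ?size_traject //.
  by rewrite take_traject // ltnW.
apply/(uniqP x) => b c; rewrite !inE size_traject => bn cn.
by rewrite !nth_traject //; apply: inj.
Qed.

Section PathEdges.
Variables (t : nat) (D : phi_data t) (c : bool) (i : 'I_t).

Let ce_iter (j : 'I_(len D i)) : j != ce D i ->
  exists2 m, 0 < m < len D i & j = iter m (@ordS _) (ce D i).
Proof.
have [m mn ->] := iter_ordS_surj (ce D i) j => jN; exists m => //.
by rewrite mn andbT lt0n; apply: contraNneq jN => ->.
Qed.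

Let up_inj b a : b < (len D i).-1 -> a < (len D i).-1 ->
  iter b (@ordS _) (ordS (ce D i)) = iter a (@ordS _) (ordS (ce D i)) -> b = a.
Proof. by move=> bn an; apply: iter_ordS_inj; lia. Qed.

Let down_inj b a : b < (len D i).-1 -> a < (len D i).-1 ->
  iter b (@ord_pred _) (ord_pred (ce D i)) =
  iter a (@ord_pred _) (ord_pred (ce D i)) -> b = a.
Proof.
move=> bn an; rewrite -!iterSr.
have E k : k < (len D i).-1 -> iter k.+1 (@ord_pred _) (ce D i) =
    iter (len D i - k.+1) (@ordS _) (ce D i).
  by move=> kn; rewrite iter_ord_pred ?leq_subr // subKn //; lia.
by rewrite !E // => /iter_ordS_inj; lia.
Qed.

(** Two facts about the naming order are extracted: how many edges are named, and that none is
    missed. *)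
Lemma path_edges_last : i.+1 == t ->
  size (path_edges D c i) = (len D i).-1 /\
  forall j, j != ce D i -> j \in path_edges D c i.
Proof.
rewrite /path_edges => ->; split; first by case: c; rewrite size_traject.
move=> j /ce_iter[m /andP[m0 mn] ->]; case: c; apply/trajectP.
  by exists m.-1; [lia|rewrite -iterSr prednK].
exists (len D i - m).-1; first lia.
by rewrite -iterSr prednK ?subn_gt0 // -iter_ord_pred // ltnW.
Qed.

Lemma path_edges_inner : i.+1 != t ->
  size (path_edges D c i) = len D i - 2 /\
  forall j, j != ce D i -> j != cf D i -> j \in path_edges D c i.
Proof.
rewrite /path_edges => /negPf ->.
(* From [ce] to [cf] there are [a] steps forward or [len D i - a] backward, so the two paths have
   [a - 1] and [len D i - a - 1] edges. *)
have [|a /andP[a0 an] fE] := @ce_iter (cf D i); first by rewrite eq_sym ce_neq_cf.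
have fE' : cf D i = iter (len D i - a).-1 (@ord_pred _) (ord_pred (ce D i)).
  by rewrite -iterSr prednK ?subn_gt0 // -iter_ord_pred // ltnW.
have -> : upto (cf D i) (traject (@ordS _) (ordS (ce D i)) (len D i).-1) =
    traject (@ordS _) (ordS (ce D i)) a.-1.
  by rewrite fE -{1}(prednK a0) iterSr upto_traject //; lia.
have -> : upto (cf D i) (traject (@ord_pred _) (ord_pred (ce D i)) (len D i).-1) =
    traject (@ord_pred _) (ord_pred (ce D i)) (len D i - a).-1.
  by rewrite fE' upto_traject //; lia.
split; first by case: c; rewrite size_cat !size_traject; lia.
move=> j /ce_iter[b /andP[b0 bn] ->] bf.
have {bf}ba : b <> a by move=> ba; rewrite ba fE eqxx in bf.
suff : iter b (@ordS _) (ce D i) \in traject (@ordS _) (ordS (ce D i)) a.-1 ++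
    traject (@ord_pred _) (ord_pred (ce D i)) (len D i - a).-1.
  by case: c; rewrite !mem_cat // orbC.
rewrite mem_cat; have [b_a|a_b] := ltnP b a; apply/orP; [left|right]; apply/trajectP.
  by exists b.-1; [lia|rewrite -iterSr prednK].
exists (len D i - b).-1; first lia.
by rewrite -iterSr prednK ?subn_gt0 // -iter_ord_pred // ltnW.
Qed.

End PathEdges.

(** Exhibiting one suitable cycle makes [pick] succeed, which excludes the empty default value. *)
Lemma fund_cycleP (G : mgraph) (lab : nat -> edge G) j (C : {set edge G}) :
  is_cycle C -> C \subset lab j |: lab_tree lab -> is_cycle (fund_cycle lab j).
Proof.
move=> cC sC; rewrite /fund_cycle; case: pickP => [C' /andP[/asboolP]//|/(_ C)].
by rewrite sC andbT; move/asboolP.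
Qed.

Lemma closed_walk_cycle (G : mgraph) M (w : nat -> vertex G) (u : nat -> edge G) :
  2 <= M -> (forall i, i < M -> ends (u i) = [set w i; w i.+1]) -> w M = w 0 ->
  (forall i j, i < M -> j < M -> w i = w j -> i = j) ->
  (forall i j, i < M -> j < M -> u i = u j -> i = j) ->
  is_cycle [set u i | i : 'I_M].
Proof.
move=> M2 uw wM winj uinj; exists M, (fun i => w i), (fun i => u i); split=> //.
- by move=> i j /winj ij; apply: ord_inj; apply: ij.
- by move=> i j /uinj ij; apply: ord_inj; apply: ij.
move=> i; rewrite uw //; congr [set _; _]; rewrite /=.
have := ltn_ord i; rewrite leq_eqVlt => /orP[/eqP E|iM]; last by rewrite modn_small.
by rewrite E modnn wM.
Qed.

Section ThetaLabeling.
Variables (n : nat) (G : phi_graph 2) (lab : nat -> edge G).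
Hypotheses (n3 : 2 < n) (GPhi : Phi n G) (labP : phi_labeling lab).
Let D := pdata G.
Let lenE i : len D i = n := GPhi.1 i.
Let i0 : 'I_2 := ord0.
Let i1 : 'I_2 := ord_max.

Lemma mem_lab_tree (i : 'I_2) (j : 'I_(len D i)) : j != ce D i ->
  (i == 0 :> nat -> j != cf D i) -> qE (mkdu j) \in lab_tree lab.
Proof.
move=> je jf; have [_ [c cE]] := labP.
have kE := cyclomatic_Phi (isT : 0 < 2) GPhi (ltnW n3).
have qE' := card_edge_Phi (isT : 0 < 2) GPhi.
have sz : size (tree_edges G c) = n - 2 + n.-1.
  rewrite size_flatten /shape -map_comp sumnE big_map big_enum /=.
  rewrite big_ord_recr big_ord1 /= !size_map.
  rewrite (path_edges_inner D (c _) (i := widen_ord _ _) _).1 //.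
  by rewrite (path_edges_last D (c ord_max) _).1 // !lenE.
have : qE (mkdu j) \in tree_edges G c.
  apply/flattenP; exists [seq qE (mkdu j) | j <- path_edges D (c i) i].
    by apply/mapP; exists i; rewrite ?mem_enum.
  apply/mapP; exists j => //; case: (eqVneq i.+1 2) => it.
    by apply: (path_edges_last _ _ _).2 => //; apply/eqP.
  apply: (path_edges_inner _ _ it).2 => //; apply: jf.
  by have := ltn_ord i; lia.
rewrite -cE => /mapP[m]; rewrite mem_iota add0n sz => /andP[_ mn] ->.
have mq : #|edge G| - m < #|edge G|.+1 by lia.
(* Here [q = 2 * n - 1] and [m < 2 * n - 3], so the name [q - m] exceeds [k = 2]. *)
by apply/imsetP; exists (Ordinal mq) => //; rewrite inE /= kE qE' /= muln1; lia.
Qed.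

Lemma lab1 : lab 1 = qE (mkdu (ce D i1)).
Proof.
by have := labP.1 i1; rewrite (cyclomatic_Phi (isT : 0 < 2) GPhi (ltnW n3)).
Qed.

Lemma lab2 : lab 2 = qE (mkdu (ce D i0)).
Proof.
by have := labP.1 i0; rewrite (cyclomatic_Phi (isT : 0 < 2) GPhi (ltnW n3)).
Qed.

(** The second cycle serves: [e_1] is its [ce], and all its other edges are in the tree. *)
Lemma fund_cycle1 : is_cycle (fund_cycle lab 1).
Proof.
apply: (@fund_cycleP _ _ _ [set qE (mkdu j) | j : 'I_(len D i1)]).
  exists (len D i1), (fun j => qV (mkdu j)), (fun j => qE (mkdu j)); split=> //.
  - exact: len_ge2.
  - exact: (qV_cycle_inj (Phi_gluings_disjoint GPhi)).
  - exact: qE_cycle_inj.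
  - by move=> j; rewrite ends_qE.
apply/fintype.subsetP => f /imsetP[j _ ->]; rewrite !inE lab1.
by have [->|je] := eqVneq j (ce D i1); [rewrite eqxx|rewrite mem_lab_tree ?orbT].
Qed.

Let N := n.-1.
Let fl := flip D i0.
(** The second arm, traversed from the end of the first arm back to its start; the flip decides
    whether this reverses its numbering. *)
Let b m := if fl then arm D i1 m else arm D i1 (N - m).
Let eb m := if fl then arm D i1 m else arm D i1 (N - m.+1).

Let b0 : qV (arm D i0 N) = qV (b 0).
Proof.
rewrite /b subn0 (arm_last n3 GPhi) (arm_last n3 GPhi); apply: vglue_qV.
rewrite /vglue /= -/i0 -/fl /shared /=.
by case: fl; rewrite ?eqxx.
Qed.

Let bN : qV (arm D i0 0) = qV (b N).
Proof.
rewrite /b subnn (arm_last n3 GPhi); apply: vglue_qV.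
rewrite /vglue /= -/i0 -/fl /shared /=.
by case: fl; rewrite ?eqxx ?orbT.
Qed.

Let eb_ends m : m < N -> ends (qE (eb m)) = [set qV (b m); qV (b m.+1)].
Proof.
move=> mN; rewrite /eb /b; case: fl.
  by rewrite (bare_ends (arm_bare n3 GPhi i1)).
rewrite (bare_ends (arm_bare n3 GPhi i1)); last by rewrite /N; lia.
by rewrite finset.setUC; have -> : (N - m.+1).+1 = N - m by lia.
Qed.

Let arms_disjoint i m : i <= N -> 0 < m < N -> qV (arm D i0 i) <> qV (b m).
Proof.
move=> iN /andP[m0 mN].
have [k kn ->] : exists2 k, k.+2 < n & b m = arm D i1 k.+1.
  rewrite /b; case: fl; [exists m.-1|exists (N - m).-1]; rewrite ?prednK //;
    by rewrite /N in mN *; lia.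
by move=> /(arm_inner n3 GPhi kn) /(congr1 (fun y : du D => val (tag y))).
Qed.

Let b_inj i j : i <= N -> j <= N -> qV (b i) = qV (b j) -> i = j.
Proof.
by move=> iN jN; rewrite /b; case: fl => /(arm_inj GPhi); rewrite /N in iN jN *; lia.
Qed.

Let eb_inj i j : i < N -> j < N -> qE (eb i) = qE (eb j) -> i = j.
Proof.
move=> iN jN; rewrite /eb; case: fl => /(arm_edge_inj GPhi);
  by rewrite /N in iN jN *; lia.
Qed.

Let eb_tree m : m < N -> qE (eb m) \in lab_tree lab.
Proof.
move=> mN; have [k kN ->] : exists2 k, k < N & eb m = arm D i1 k.
  by rewrite /eb; case: fl; [exists m|exists (N - m.+1)] => //; lia.
apply: mem_lab_tree => //; apply/eqP => E.
have := arm_last n3 GPhi i1; rewrite /shared /= -E => /(congr1 (fun x => qV x)).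
by move=> /(arm_inj GPhi); rewrite /N in kN *; lia.
Qed.

(** One endpoint of [eb m] is inner to the second arm, hence off the first. *)
Let edge_arms_disjoint i m : i < N -> m < N -> qE (arm D i0 i) <> qE (eb m).
Proof.
move=> iN mN E; have := congr1 (@ends _) E.
rewrite eb_ends // (bare_ends (arm_bare n3 GPhi i0)) // => /setP ee.
have [k kN kb] : exists2 k, 0 < k < N & qV (b k) \in [set qV (b m); qV (b m.+1)].
  case: (posnP m) => m0; [exists m.+1|exists m]; rewrite ?inE ?eqxx ?orbT //.
    by rewrite /N in mN *; lia.
  by rewrite m0.
move: kb; rewrite -ee !inE => /orP[] /eqP/esym; apply: arms_disjoint => //.
exact: ltnW.
Qed.

(** The two arms together form a cycle of length [2 * N] through [e_2]; it avoids the shared edge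
    [e_1], so its other edges are tree edges. *)
Lemma fund_cycle2 : is_cycle (fund_cycle lab 2).
Proof.
pose w i := qV (if i < N then arm D i0 i else b (i - N)).
pose u i := qE (if i < N then arm D i0 i else eb (i - N)).
have N2 : 1 < N by rewrite /N; lia.
apply: (@fund_cycleP _ _ _ [set u i | i : 'I_(N + N)]).
  apply: (closed_walk_cycle (w := w)); rewrite /w /u.
  - lia.
  - move=> i iN; case: (ltnP i N) => iN'.
      rewrite (bare_ends (arm_bare n3 GPhi i0)) //; case: ltnP => // Ni.
      have -> : i.+1 = N by lia.
      by rewrite subnn b0.
    by rewrite ltnNge (leqW iN') /= eb_ends ?subSn //; lia.
  - by rewrite ltnNge leq_addr /= addnK (ltnW N2) -bN.
  - have H i j : i < N -> N <= j -> j < N + N ->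
        qV (arm D i0 i) = qV (b (j - N)) -> i = j.
      move=> iN Nj jN; case: (posnP (j - N)) => j0; last first.
        by move/arms_disjoint; case; lia.
      by rewrite j0 -b0 => /(arm_inj GPhi); rewrite /N in iN *; lia.
    move=> i j iN jN; case: (ltnP i N) => iN'; case: (ltnP j N) => jN'.
    + by move=> /(arm_inj GPhi); rewrite /N in iN' jN' *; lia.
    + exact: H.
    + by move=> /esym/H-> //.
    + by move=> /b_inj; lia.
  - move=> i j iN jN; case: (ltnP i N) => iN'; case: (ltnP j N) => jN'.
    + by move=> /(arm_edge_inj GPhi); rewrite /N in iN' jN' *; lia.
    + by move/edge_arms_disjoint; case; lia.
    + by move/esym/edge_arms_disjoint; case; lia.
    + by move=> /eb_inj; lia.
apply/fintype.subsetP => f /imsetP[i _ ->]; rewrite !inE lab2 /u.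
case: ltnP => iN; last by rewrite eb_tree ?orbT //; have := ltn_ord i; lia.
rewrite /arm; set j := iter _ _ _.
have [->|je] := eqVneq j (ce D i0); first by rewrite eqxx.
rewrite (mem_lab_tree je) ?orbT // => _; apply/eqP => jf.
have := arm_last n3 GPhi i0; rewrite /shared /= -jf => /(congr1 (fun x => qV x)).
by move=> /(arm_inj GPhi); rewrite /N in iN *; lia.
Qed.

Lemma card_fund_cycle i : 0 < i <= 2 -> n.-1 <= #|fund_cycle lab i|.
Proof.
move=> i2; apply: (card_cycle n3 GPhi); case: i i2 => [|[|[|i]]] // _.
  exact: fund_cycle1.
exact: fund_cycle2.
Qed.

End ThetaLabeling.

Import Order.TTheory GRing.Theory Num.Theory.
Import numFieldNormedType.Exports.

(** * Lower bound for [beta] *)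

Section BetaBound.
Local Open Scope ring_scope.

Lemma beta_ge (R : realType) (G : mgraph) (a : nat) :
  (a <= #|[set v : vertex G | 2 < deg v]|)%N ->
  4 ^+ a * (7 / 8) ^+ #|edge G| <= beta R G.
Proof.
move=> aG; apply: ler_pM; rewrite ?exprn_ge0 //.
- rewrite -natrX -natr_prod ler_nat; apply: leq_trans (prod_deg_ge G).
  by rewrite leq_exp2l.
rewrite -prodr_const; apply: ler_prod => e _; apply/andP; split.
  by apply: divr_ge0.
(* By [expR x >= 1 + x] each factor is at least [7 / 8]: the product over the two ends is at least
   4, so [x >= - 1 / 8]. *)
apply: le_trans (expR_ge1Dx _).
have : 4 <= \prod_(v in ends e) (deg v).+1%:R :> R.
  by rewrite -natr_prod (ler_nat _ 4); apply: prod_ends_ge.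
move: (\prod_(v in ends e) _) => P P4.
have : P^-1 <= 4^-1 by rewrite lef_pV2 ?posrE; lra.
rewrite mulN1r invfM; lra.
Qed.

End BetaBound.

(** * Weighted count of monomials and bounds for [gamma] *)

(** All degrees up to [P] are counted inside one finite type of exponent vectors, so that the sum
    over [d] can be merged. *)
Lemma card_L (k P d : nat) (m : mpoly.multinom k) : d <= P ->
  #|L d m| = #|[set w : {ffun 'I_k -> 'I_P.+1} |
                 (\sum_i w i == d) && [forall i, w i <= m i]]|.
Proof.
move=> dP; pose phi (u : mpoly.bmultinom k d.+1) : {ffun 'I_k -> 'I_P.+1} :=
  [ffun i => inord (mpoly.bmnm u i)].
have phiE u i : u \in L d m -> phi u i = mpoly.bmnm u i :> nat.
  rewrite inE => /andP[/eqP ud _]; rewrite ffunE inordK // ltnS.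
  apply: leq_trans dP; apply: leq_trans (eq_leq ud); rewrite mpoly.mdegE.
  by rewrite (bigD1 i) //= leq_addr.
rewrite -(card_in_imset (f := phi)); last first.
  move=> u v uL vL uv; apply: val_inj; apply/mpoly.mnmP => i.
  by rewrite -(phiE u) // -(phiE v) // uv.
apply: eq_card => w; apply/imsetP/idP => [[u uL ->]|].
  rewrite inE (eq_bigr _ (fun i _ => phiE u i uL)) -mpoly.mdegE.
  have := uL; rewrite inE => /andP[-> /forallP ule] /=.
  by apply/forallP => i; rewrite phiE.
rewrite inE => /andP[/eqP wd /forallP wm].
pose u := mpoly.Multinom [tuple (w i : nat) | i < k].
have uE i : u i = w i by rewrite mpoly.multinomE tnth_mktuple.
have ud : mpoly.mdeg u = d by rewrite mpoly.mdegE -wd; apply: eq_bigr => i _.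
have ud' : mpoly.mdeg u < d.+1 by rewrite ud.
have uL : mpoly.BMultinom ud' \in L d m.
  by rewrite inE /= ud eqxx /=; apply/forallP => i; rewrite uE.
exists (mpoly.BMultinom ud') => //; apply/ffunP => i.
by apply: ord_inj; rewrite phiE // uE.
Qed.

Section WeightedCount.
Local Open Scope ring_scope.
Variables (R : realType) (k P : nat) (m : mpoly.multinom k).

Lemma sum_LE :
  (\sum_(d < P.+1) #|L d m| * 2 ^ (P.+1 - d - 1))%:R =
  2 ^+ P * \sum_(w : {ffun 'I_k -> 'I_P.+1} |
      (\sum_i w i <= P)%N && [forall i, (w i <= m i)%N])
      \prod_i (2^-1) ^+ w i :> R.
Proof.
(* Vectors are grouped by total degree; [inord] is exact because this degree is at most [P]. *)
rewrite natr_sum (partition_big (fun w : {ffun 'I_k -> 'I_P.+1} =>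
  inord (\sum_i w i)%N : 'I_P.+1) predT) //= mulr_sumr.
apply: eq_bigr => d _; have dP : (d <= P)%N by rewrite -ltnS.
rewrite (eq_bigl (fun w => w \in [set w : {ffun 'I_k -> 'I_P.+1} |
   (\sum_i w i == d)%N && [forall i, (w i <= m i)%N]])); last first.
  move=> w; rewrite inE; apply/andP/andP => -[].
    by move=> /andP[wP ->] /eqP <-; rewrite inordK.
  move=> /eqP wd ->; rewrite wd dP; split=> //.
  by apply/eqP/val_inj; rewrite /= inordK.
rewrite (eq_bigr (fun=> (2^-1) ^+ d)); last first.
  by move=> w; rewrite inE => /andP[/eqP wd _]; rewrite -expr_sum wd.
rewrite sumr_const (card_L m dP) natrM natrX -[X in _ = _ * X]mulr_natl mulrCA.
congr (_ * _).
have -> : (P.+1 - d - 1 = P - d)%N by lia.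
rewrite -[X in _ ^+ X * _](subnK dP) exprD -mulrA -exprMn.
by rewrite divff ?pnatr_eq0 // expr1n mulr1.
Qed.

Lemma sum_half N : \sum_(a < N) (2^-1) ^+ a = 2 - 2 * (2^-1) ^+ N :> R.
Proof.
elim: N => [|N IHN]; first by rewrite big_ord0 expr0; lra.
by rewrite big_ord_recr /= IHN exprS; lra.
Qed.

(** Dropping the constraints leaves the full box of exponents, where the sum is a product of [k]
    geometric sums below 2. *)
Lemma sum_L_le :
  (\sum_(d < P.+1) #|L d m| * 2 ^ (P.+1 - d - 1))%:R <= 2 ^+ (P + k) :> R.
Proof.
rewrite sum_LE exprD ler_pM2l ?exprn_gt0 //.
have h0 a : 0 <= (2^-1 : R) ^+ a by apply: exprn_ge0.
apply: (@le_trans _ _ (\prod_(i < k) \sum_(a < P.+1) (2^-1) ^+ a)).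
  rewrite bigA_distr_bigA /= big_mkcond; apply: ler_sum => w _.
  by case: ifP => _ //; apply: prodr_ge0.
rewrite prodr_const card_ord lerXn2r ?nnegrE ?sumr_ge0 //.
by rewrite sum_half; have := h0 P.+1; lra.
Qed.

(** Only the box of exponents at most [M] is kept; [k * M <= P] puts it within the degree bound. *)
Lemma sum_L_ge M : (forall i, M <= m i)%N -> (k * M <= P)%N -> (M <= P)%N ->
  2 ^+ P * (2 - 2 * (2^-1) ^+ M.+1) ^+ k <=
  (\sum_(d < P.+1) #|L d m| * 2 ^ (P.+1 - d - 1))%:R :> R.
Proof.
move=> Mm kM MP; rewrite sum_LE ler_pM2l ?exprn_gt0 //.
have h0 a : 0 <= (2^-1 : R) ^+ a by apply: exprn_ge0.
(* Padding with zeros makes the power expand over the same functions as in [sum_LE]. *)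
have <- : \sum_(a < P.+1) (if (a < M.+1)%N then (2^-1) ^+ a else 0) =
    2 - 2 * (2^-1) ^+ M.+1 :> R.
  by rewrite -big_mkcond -(big_ord_widen P.+1 (fun a => (2^-1) ^+ a)) // sum_half.
rewrite -[X in _ ^+ X](card_ord k) -prodr_const bigA_distr_bigA /= [leRHS]big_mkcond.
apply: ler_sum => w _; have [wM|/forallPn[i wi]] := boolP [forall i, (w i < M.+1)%N].
  have /forallP wM' := wM; rewrite (eq_bigr (fun i => (2^-1) ^+ w i)); last first.
    by move=> i _; rewrite wM'.
  rewrite ifT //; apply/andP; split; last first.
    by apply/forallP => i; apply: leq_trans (Mm i); apply: wM'.
  apply: leq_trans kM; rewrite -[X in (X * _)%N]card_ord -sum_nat_const.
  by apply: leq_sum => i _; apply: wM'.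
rewrite (bigD1 i) //= (negPf wi) mul0r; case: ifP => // _.
exact: prodr_ge0.
Qed.

End WeightedCount.

Section GammaBounds.
Local Open Scope ring_scope.
Variables (R : realType) (G : mgraph) (lab : nat -> edge G).

Lemma gamma_le (q : nat) : (0 < #|vertex G|)%N ->
  (#|vertex G| + cyclomatic G <= q.+1)%N -> (gamma lab)%:R <= 2 ^+ q :> R.
Proof.
rewrite /gamma; move: (#|vertex G|) => [|P] // _ Pq.
apply: le_trans (sum_L_le _ _ _) _.
by rewrite ler_weXn2l ?ler1n //; lia.
Qed.

Lemma gamma_ge (M : nat) :
  (forall i, (0 < i <= cyclomatic G)%N -> (M.+2 <= #|fund_cycle lab i|)%N) ->
  (cyclomatic G * M < #|vertex G|)%N -> (M < #|vertex G|)%N ->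
  2 ^+ (#|vertex G|.-1) * (2 - 2 * (2^-1) ^+ M.+1) ^+ cyclomatic G
    <= (gamma lab)%:R :> R.
Proof.
move=> HM; rewrite /gamma; move: (#|vertex G|) => [|P] // kP MP.
apply: sum_L_ge => // i.
rewrite mpoly.multinomE tnth_mktuple; have := HM i.+1.
by rewrite ltn_ord => /(_ isT); lia.
Qed.

End GammaBounds.

(** * Asymptotic comparison for both families *)

Section Asymptotics.
Local Open Scope classical_set_scope.
Local Open Scope ring_scope.
Variable R : realType.

Lemma theta_gamma_bounds n (G : phi_graph 2) (lab : nat -> edge G) :
  (4 <= n)%N -> Phi n G -> phi_labeling lab ->
  (1 - 8 * (2^-1) ^+ n) * (2 : R) ^+ (2 * n - 1) <= (gamma lab)%:R
    <= (2 : R) ^+ (2 * n - 1).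
Proof.
move=> n4 GPhi labP; have n3 : (2 < n)%N by lia.
have kE := cyclomatic_Phi (isT : 0 < 2)%N GPhi (ltnW n3).
have pE := card_vertex_Phi (isT : 0 < 2)%N GPhi; rewrite /= muln1 in pE.
apply/andP; split; last by apply: gamma_le; rewrite ?kE pE; lia.
(* Fundamental cycles have at least [n - 1 = m + 2] edges, so all exponents are at least [m]. *)
have [m nE] : exists m, n = m.+3 by exists (n - 3)%N; lia.
have H := @gamma_ge R G lab m; rewrite kE pE in H.
apply: le_trans (H _ _ _); last first.
- by rewrite nE; lia.
- by rewrite nE; lia.
- by move=> i /(card_fund_cycle n3 GPhi labP); rewrite nE.
have -> : 2 ^+ (2 * n - 1) = 4 * 2 ^+ (n + (n - 2)).-1 :> R.
  have -> : (2 * n - 1 = (n + (n - 2)).-1.+2)%N by lia.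
  by rewrite !exprS; ring.
have -> : (2^-1) ^+ n = 4^-1 * (2^-1) ^+ m.+1 :> R.
  by rewrite nE !exprS; lra.
rewrite mulrCA mulrA mulrC ler_pM2l ?exprn_gt0 // expr2.
have : 0 <= (2^-1) ^+ m.+1 :> R by apply: exprn_ge0.
(* The constant 8 comes from [(1 - y) ^ 2 >= 1 - 2 * y] with [y = 4 * 2 ^- n]. *)
by move: (_ ^+ m.+1) => y y0; nra.
Qed.

Lemma theta_alpha_bounds n (G : phi_graph 2) :
  (4 <= n)%N -> Phi n G ->
  (1 - 8 * (2^-1) ^+ n) * (2 : R) ^+ (2 * n - 1) <= (alpha G)%:R
    <= (2 : R) ^+ (2 * n - 1).
Proof.
move=> n4 GPhi; have n3 : (2 < n)%N by lia.
have qE := card_edge_Phi (isT : 0 < 2)%N GPhi; rewrite /= muln1 in qE.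
have q2 : (#|edge G| = 2 * n - 1)%N by rewrite qE; lia.
apply/andP; split; last by rewrite -natrX ler_nat -q2 alpha_le.
have := alpha_ge n3 GPhi; rewrite q2 -(ler_nat R) natrD natrM !natrX.
(* The error [4 * 2 ^ n] is [8 * 2 ^- n] times [2 ^ (2 * n - 1)], the same relative error as for
   [gamma]. *)
have -> : (2 * n - 1 - n.-1 = n)%N by lia.
have -> : (2 * n - 1 = n + n.-1)%N by lia.
have [m nE] : exists m, n = m.+1 by exists n.-1; lia.
rewrite nE /= exprD => H.
have E : (2^-1) ^+ m.+1 * 2 ^+ m.+1 = 1 :> R.
  by rewrite -exprMn mulVf ?expr1n ?pnatr_eq0.
have -> : (1 - 8 * (2^-1) ^+ m.+1) * (2 ^+ m.+1 * 2 ^+ m) =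
  2 ^+ m.+1 * 2 ^+ m - 8 * ((2^-1) ^+ m.+1 * 2 ^+ m.+1) * 2 ^+ m :> R by ring.
rewrite E; move: H; rewrite !exprS; lra.
Qed.

Lemma cvg_geometric_affine (c : R) : (1 - c * (2^-1) ^+ n) @[n --> \oo] --> (1 : R).
Proof.
rewrite -[X in _ --> X]subr0 -[X in _ - X](mulr0 c).
apply: cvgB; first exact: cvg_cst.
apply: cvgM; first exact: cvg_cst.
by apply: cvg_expr; rewrite ger0_norm ?invr_ge0 // invf_lt1 ?ltr1n.
Qed.

(** The ratio is squeezed between [1 - c * 2 ^- n] and its inverse. *)
Lemma asymp_equiv_of_bounds (f g : nat -> R) (b : nat -> R) (c : R) :
  (forall n, (4 <= n)%N -> 0 < b n /\ c * (2^-1) ^+ n < 1) ->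
  (forall n, (4 <= n)%N -> (1 - c * (2^-1) ^+ n) * b n <= f n <= b n) ->
  (forall n, (4 <= n)%N -> (1 - c * (2^-1) ^+ n) * b n <= g n <= b n) ->
  asymp_equiv f g.
Proof.
move=> b0 fb gb; have cv := cvg_geometric_affine c.
apply: (@squeeze_cvgr _ _ _ _ (fun n => 1 - c * (2^-1) ^+ n)
  (fun n => (1 - c * (2^-1) ^+ n)^-1)).
- near=> n; have n4 : (4 <= n)%N by near: n; exists 4%N.
  have [bn cn] := b0 n n4.
  have /andP[f1 f2] := fb n n4; have /andP[g1 g2] := gb n n4.
  have c0 : 0 < 1 - c * (2^-1) ^+ n by lra.
  have g0 : 0 < g n by apply: lt_le_trans g1; apply: mulr_gt0.
  rewrite ler_pdivlMr // ler_pdivrMr // mulrC ler_pdivlMl //.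
  apply/andP; split.
    by apply: le_trans f1; rewrite mulrC ler_pM2l.
  by apply: le_trans g1; rewrite ler_pM2l.
- exact: cv.
- by rewrite -[X in _ --> X]invr1; apply: cvgV; rewrite ?oner_eq0.
Unshelve. all: by end_near.
Qed.

(** Each further cycle multiplies the bound for [gamma] by 8 and that for [beta] by
    [16 * (7 / 8) ^ 3], whose quotient is [256 / 343]; the case [t = 1] gives [16 / (7 / 8) ^ 4],
    which fixes the factor [256 / 7]. *)
Lemma ladder_ratio t (G : phi_graph t) (lab : nat -> edge G) :
  (1 <= t)%N -> Phi 4 G ->
  0 <= (gamma lab)%:R / beta R G <= 256 / 7 * (256 / 343) ^+ t.
Proof.
move=> t1 GPhi.
have kE := cyclomatic_Phi t1 GPhi isT.
have pE := card_vertex_Phi t1 GPhi.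
have qE := card_edge_Phi t1 GPhi.
have bge := beta_ge R (card_deg_gt2 GPhi t1).
have b0 : 0 < beta R G.
  by apply: lt_le_trans bge; apply: mulr_gt0; apply: exprn_gt0; rewrite ?divr_gt0.
apply/andP; split; first by rewrite divr_ge0 // ltW.
rewrite ler_pdivrMr //.
have : (gamma lab)%:R <= 2 ^+ (3 * t + 1) :> R.
  by apply: gamma_le; rewrite ?kE pE; lia.
move/le_trans; apply; apply: (@le_trans _ _ (256 / 7 * (256 / 343) ^+ t *
    (4 ^+ (2 * t.-1) * (7 / 8) ^+ #|edge G|))); last first.
  by rewrite ler_pM2l // mulr_gt0 ?exprn_gt0 // divr_gt0.
rewrite qE; case: t t1 {G lab GPhi kE pE qE bge b0} => // s _ /=.
have -> : (3 * s.+1 + 1 = 4 + 3 * s)%N by lia.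
have -> : ((4 - 1) * s = 3 * s)%N by [].
rewrite 2!(exprD _ 4 (3 * s)) 2!(exprM _ 3 s) (exprM _ 2 s) (exprS _ s).
have -> : 2 ^+ 4 * (2 ^+ 3) ^+ s = 16 * 8 ^+ s :> R.
  by congr (_ * _ ^+ _); ring.
have E : 8 ^+ s = (256 / 343) ^+ s * (4 ^+ 2) ^+ s * ((7 / 8) ^+ 3) ^+ s :> R.
  by rewrite -!exprMn; congr (_ ^+ _); field.
rewrite E le_eqVlt; apply/orP; left; apply/eqP.
move: (_ ^+ s) ((4 ^+ 2) ^+ s) (((7 / 8) ^+ 3) ^+ s) => x y z.
by field.
Qed.

End Asymptotics.

Theorem theorem5p4 (R : realType) :
  (forall f g : nat -> R,
     (forall n : nat, 4 <= n ->
        exists (G : phi_graph 2) (lab : nat -> edge G),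
          [/\ Phi n G, phi_labeling lab,
              f n = (gamma lab)%:R%R & g n = (alpha G)%:R%R]) ->
     asymp_equiv f g)
  /\
  (forall f g : nat -> R,
     (forall t : nat, 1 <= t ->
        exists (G : phi_graph t) (lab : nat -> edge G),
          [/\ Phi 4 G, phi_labeling lab,
              f t = (gamma lab)%:R%R & g t = beta R G]) ->
     asymp_negl f g).
Proof.
split=> f g fg.
  apply: (asymp_equiv_of_bounds (b := fun n => 2 ^+ (2 * n - 1)) (c := 8))%R => n n4.
  - split; first by rewrite exprn_gt0.
    (* As [n >= 4], [2 ^ n] is at least 16, hence above 8. *)
    rewrite exprVn ltr_pdivrMr ?exprn_gt0 // mul1r.
    apply: (@lt_le_trans _ _ (2 ^+ 4)%R); first by rewrite !exprS expr0; lra.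
    by rewrite ler_weXn2l ?ler1n.
  - by have [G [lab [GPhi labP -> _]]] := fg n n4; apply: theta_gamma_bounds.
  - by have [G [lab [GPhi _ _ ->]]] := fg n n4; apply: theta_alpha_bounds.
rewrite /asymp_negl.
apply: (@squeeze_cvgr _ _ _ _ (fun=> 0%R) (fun t => 256 / 7 * (256 / 343) ^+ t)%R).
- near=> t; have t1 : 1 <= t by near: t; exists 1.
  by have [G [lab [GPhi _ -> ->]]] := fg t t1; apply: ladder_ratio.
- exact: cvg_cst.
- rewrite -[X in (_ --> X)%classic](mulr0 (256 / 7)%R).
  apply: cvgM; first exact: cvg_cst.
  by apply: cvg_expr; rewrite ger0_norm ?divr_ge0 // ltr_pdivrMr // mul1r ltr_nat.
Unshelve. all: by end_near.
Qed.
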